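(* Let $P$ be a positive recurrent transition matrix of $M/G/1$ type, let $N,M\ge0$, and let $U,D,Q$ be the blocks of its partition according to $L_{\le N}$ and $L_{\le N}^c$ as described in the context. With $G^{(m)}=(Q^mD)_{:,N}$, define the truncation error column $$E^{(M)}=(\hat QD)_{:,N}-(\hat Q^{(M)}D)_{:,N}=\sum_{m=M+1}^\infty G^{(m)},$$ the error matrix $\Delta^{(M)}=U(\hat QD-\hat Q^{(M)}D)$ (a matrix of $(N+1)\times(N+1)$ blocks whose last block-column is $U E^{(M)}$ and whose other block-columns are zero), and, for $s\ge0$ and $p\in\{1,\dots,r\}$, $$r_{s,p}^{(M)}=\sum_{m=0}^M\sum_{d=1}^r\bigl[G_s^{(m)}\bigr]_{p,d}.$$ Then the following hold. (a) For every $s\ge0$, $E_s^{(M)}=\sum_{m=M+1}^\infty G_s^{(m)}$; hence all entries of $E^{(M)}$ and $\Delta^{(M)}$ are nonnegative. (b) For every $0\le i\le N$ and $\alpha,\beta\in\{1,\dots,r\}$, $$\bigl[\Delta_{i,N}^{(M)}\bigr]_{\alpha,\beta}\le\sum_{s\ge0}\sum_{p=1}^rU_{i,s}(\alpha,p)\bigl(1-r_{s,p}^{(M)}\bigr),$$ where $U_{i,s}(\alpha,p)$ is the $(\alpha,p)$ entry of the block $U_{i,s}$. (c) Consequently, $$\max_{i,\alpha,\beta}\bigl[\Delta_{i,N}^{(M)}\bigr]_{\alpha,\beta}\le\max_{s\ge0}\max_{p=1,\dots,r}\bigl(1-r_{s,p}^{(M)}\bigr).$$ Therefore, for $\varepsilon>0$,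 if $\min_{s\ge0,\,p}r_{s,p}^{(M)}\ge1-\varepsilon$, equivalently if $\max_{s\ge0,\,p}(1-r_{s,p}^{(M)})\le\varepsilon$, then every scalar entry of $\Delta^{(M)}$ is bounded by $\varepsilon$.
   Context: Fix an integer $r\ge1$. The state space is $S=\bigcup_{i\ge0}L_i$ with levels $L_i=\{(i,\alpha):\alpha=1,\dots,r\}$; $L_{\le N}=\bigcup_{i=0}^N L_i$ and $L_{\le N}^c=S\setminus L_{\le N}$. A transition (stochastic) matrix $P=(P_{i,j})_{i,j\ge0}$ with $r\times r$ blocks is of $M/G/1$ type if $P_{0,j}=B_j$ for $j\ge0$, $P_{i,j}=A_{j-i}$ for $i\ge1$, $j\ge i-1$, and $P_{i,j}=0$ otherwise, where $B_k$ ($k\ge 0$), $A_k$ ($k\ge -1$) are nonnegative $r\times r$ matrices; set $A_k=0$ for $k<-1$. Partition: $P=\begin{pmatrix}T_N&U\\ D&Q\end{pmatrix}$ according to $L_{\le N}$ and $L_{\le N}^c$. With complement levels $N+1,N+2,\dots$ renumbered $0,1,\dots$: $Q_{i,t}=A_{t-i}$ ($i,t\ge0$); $U_{0,s}=B_{N+1+s}$ and $U_{i,s}=A_{N+1+s-i}$ for $1\le i\le N$, $s\ge0$; $D$ has all blocks zero except $D_{0,N}=A_{-1}$. $\hat Q=\sum_{m=0}^\infty Q^m$ and $\hat Q^{(M)}=\sum_{m=0}^MQ^m$. The censored matrix is $P^{(N)}=T_N+U\hat QD$ and the approximated (truncated) censored matrix is $P^{(N;M)}=T_N+U\hat Q^{(M)}D$,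 so $\Delta^{(M)}=P^{(N)}-P^{(N;M)}$. For a block matrix $X$, $X_{:,N}$ denotes its block-column with index $N$; $G^{(m)}_s$ and $E^{(M)}_s$ denote the $r\times r$ blocks at (renumbered) complement level $s\ge0$ of $G^{(m)}$ and $E^{(M)}$. *)

(* Defs.v *)
From HB Require Import structures.
From mathcomp Require Import all_boot all_order all_algebra.
From mathcomp Require Import all_classical all_reals all_analysis.
From mathcomp Require Import zify.

Set Implicit Arguments.
Unset Strict Implicit.
Unset Printing Implicit Defensive.

Import Order.TTheory GRing.Theory Num.Theory.

Local Open Scope classical_set_scope.
Local Open Scope ring_scope.
Local Open Scope ereal_scope.

(* Possibly infinite matrices with entries in [-oo, +oo].  Products are        *)
(* unordered sums ([esum] is a supremum of finite partial sums), hence are     *)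
(* meaningful only for nonnegative matrices; 0 * +oo = 0.                      *)
Definition imx (R : realType) (I J : Type) := I -> J -> \bar R.

Definition imx1 (R : realType) (I : choiceType) : imx R I I :=
  fun x y => if x == y then 1 else 0.

Definition imxD (R : realType) (I J : Type) (X Y : imx R I J) : imx R I J :=
  fun x y => X x y + Y x y.

Definition imxB (R : realType) (I J : Type) (X Y : imx R I J) : imx R I J :=
  fun x y => X x y - Y x y.

Definition imxM (R : realType) (I K : Type) (J : choiceType)
    (X : imx R I J) (Y : imx R J K) : imx R I K :=
  fun x z => \esum_(y in [set: J]) (X x y * Y y z).

Definition imxX (R : realType) (I : choiceType) (X : imx R I I) (m : nat) :
  imx R I I := iter m (imxM X) (@imx1 R I).

(* (i, a) is the state of level i with phase a; phases are numbered from 0. *)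
Definition state (r : nat) : choiceType := (nat * 'I_r)%type.

Definition stochastic (R : realType) (r : nat) (P : state r -> state r -> R) :=
  (forall x y, (0 <= P x y)%R) /\
  (forall x, \esum_(y in [set: state r]) (P x y)%:E = 1).

(* A is indexed by int so that A k is the paper's block with the same index;  *)
(* its values at k < -1 are irrelevant.                                       *)
Definition MG1_blocks (R : realType) (r : nat) (B : nat -> 'M[R]_r)
    (A : int -> 'M[R]_r) (P : state r -> state r -> R) :=
  forall (i j : nat) (a b : 'I_r),
    P (i, a) (j, b) =
      if i == 0%N then B j a b
      else if (i.-1 <= j)%N then A (j%:Z - i%:Z)%R a b else 0%R.

Definition MG1_type (R : realType) (r : nat) (P : state r -> state r -> R) :=
  exists (B : nat -> 'M[R]_r) (A : int -> 'M[R]_r),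
    [/\ forall k a b, (0 <= B k a b)%R,
        forall k a b, (0 <= A k a b)%R
      & MG1_blocks B A P].

(* Probability that the chain started at x is at y at time n, and not at y at  *)
(* any of the times 1, ..., n - 1.                                             *)
Fixpoint first_passage (R : realType) (r : nat) (P : state r -> state r -> R)
    (n : nat) (x y : state r) : \bar R :=
  if n is n'.+1 then
    if n' is 0%N then (P x y)%:E
    else \esum_(z in [set z | z <> y]) ((P x z)%:E * first_passage P n' z y)
  else 0.

(* Almost sure return and finite mean return time, for every state;            *)
(* irreducibility is not part of the definition.                               *)
Definition positive_recurrent (R : realType) (r : nat)
    (P : state r -> state r -> R) :=
  forall x,
    \sum_(n <oo) first_passage P n x x = 1 /\
    \sum_(n <oo) (n%:R%:E * first_passage P n x x) < +oo.

(* States of the levels 0, ..., N.  The states of the levels > N are           *)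
(* represented by [state r], with level N.+1 + s renumbered s.                 *)
Definition low (N r : nat) : choiceType := ('I_N.+1 * 'I_r)%type.

Definition of_low (N r : nat) (x : low N r) : state r := (val x.1, x.2).

Definition of_high (N r : nat) (x : state r) : state r := ((N.+1 + x.1)%N, x.2).

Definition blockT (R : realType) (r : nat) (P : state r -> state r -> R)
  (N : nat) : imx R (low N r) (low N r) :=
  fun x y => (P (of_low x) (of_low y))%:E.
Arguments blockT {R r} P N x y.

Definition blockU (R : realType) (r : nat) (P : state r -> state r -> R)
  (N : nat) : imx R (low N r) (state r) :=
  fun x y => (P (of_low x) (of_high N y))%:E.
Arguments blockU {R r} P N x y.

Definition blockD (R : realType) (r : nat) (P : state r -> state r -> R)
  (N : nat) : imx R (state r) (low N r) :=
  fun x y => (P (of_high N x) (of_low y))%:E.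
Arguments blockD {R r} P N x y.

Definition blockQ (R : realType) (r : nat) (P : state r -> state r -> R)
  (N : nat) : imx R (state r) (state r) :=
  fun x y => (P (of_high N x) (of_high N y))%:E.

Definition Qhat (R : realType) (r : nat) (P : state r -> state r -> R)
  (N : nat) : imx R (state r) (state r) :=
  fun x y => \sum_(m <oo) imxX (blockQ P N) m x y.

Definition Qhat_trunc (R : realType) (r : nat) (P : state r -> state r -> R)
  (N M : nat) : imx R (state r) (state r) :=
  fun x y => \sum_(m < M.+1) imxX (blockQ P N) m x y.

Definition censored (R : realType) (r : nat) (P : state r -> state r -> R)
  (N : nat) : imx R (low N r) (low N r) :=
  imxD (blockT P N) (imxM (blockU P N) (imxM (Qhat P N) (blockD P N))).
Arguments censored {R r} P N x y.

Definition censored_trunc (R : realType) (r : nat)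
  (P : state r -> state r -> R) (N M : nat) : imx R (low N r) (low N r) :=
  imxD (blockT P N)
       (imxM (blockU P N) (imxM (Qhat_trunc P N M) (blockD P N))).
Arguments censored_trunc {R r} P N M x y.

Definition Delta (R : realType) (r : nat) (P : state r -> state r -> R)
  (N M : nat) : imx R (low N r) (low N r) :=
  imxB (censored P N) (censored_trunc P N M).
Arguments Delta {R r} P N M x y.

(* Block-column with index N. *)
Definition last_col (R : realType) (r N : nat) (I : Type)
  (X : imx R I (low N r)) : imx R I 'I_r := fun x d => X x (ord_max, d).

Definition Gcol (R : realType) (r : nat) (P : state r -> state r -> R)
  (N m : nat) : imx R (state r) 'I_r :=
  last_col (imxM (imxX (blockQ P N) m) (blockD P N)).

Definition Ecol (R : realType) (r : nat) (P : state r -> state r -> R)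
  (N M : nat) : imx R (state r) 'I_r :=
  imxB (last_col (imxM (Qhat P N) (blockD P N)))
       (last_col (imxM (Qhat_trunc P N M) (blockD P N))).

Definition rsum (R : realType) (r : nat) (P : state r -> state r -> R)
  (N M : nat) (s : nat) (p : 'I_r) : \bar R :=
  \sum_(m < M.+1) \sum_(d < r) Gcol P N m (s, p) d.

Lemma blockU_MG1 (R : realType) (r : nat) (B : nat -> 'M[R]_r)
    (A : int -> 'M[R]_r) (P : state r -> state r -> R) (N : nat)
    (i : 'I_N.+1) (s : nat) (a p : 'I_r) :
  MG1_blocks B A P ->
  blockU P N (i, a) (s, p) =
    (if val i == 0%N then B (N.+1 + s)%N a p
     else A ((N.+1 + s)%N%:Z - (val i)%:Z)%R a p)%:E.
Proof.
move=> PE; rewrite /blockU PE /=; case: (val i =P 0%N) => // _.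
by rewrite (leq_trans (leq_pred _)) // (leq_trans (ltnW (ltn_ord i))) ?leq_addr.
Qed.

Lemma blockQ_MG1 (R : realType) (r : nat) (B : nat -> 'M[R]_r)
    (A : int -> 'M[R]_r) (P : state r -> state r -> R) (N i t : nat)
    (a b : 'I_r) :
  MG1_blocks B A P ->
  blockQ P N (i, a) (t, b) =
    (if (i <= t.+1)%N then A (t%:Z - i%:Z)%R a b else 0%R)%:E.
Proof.
move=> PE; rewrite /blockQ PE /= addSn /= -addnS leq_add2l.
by case: ifP => // _; congr (A _ _ _)%:E; lia.
Qed.

Lemma blockD_MG1 (R : realType) (r : nat) (B : nat -> 'M[R]_r)
    (A : int -> 'M[R]_r) (P : state r -> state r -> R) (N i : nat)
    (j : 'I_N.+1) (a b : 'I_r) :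
  MG1_blocks B A P ->
  blockD P N (i, a) (j, b) =
    (if (i == 0%N) && (j == ord_max) then A (-1)%R a b else 0%R)%:E.
Proof.
move=> PE; rewrite /blockD PE /= addSn /=.
have -> : (N + i <= j)%N = (i == 0%N) && (j == ord_max).
  rewrite -val_eqE /=; apply/idP/andP => [h|[/eqP-> /eqP->]]; last by rewrite addn0.
  have jN : (j <= N)%N by rewrite -ltnS.
  have i0 : i = 0%N.
    by apply/eqP; rewrite -leqn0 -(leq_add2l N) addn0 (leq_trans h).
  move: h; rewrite i0 addn0 => h; split=> //; by rewrite eqn_leq jN h.
case: ifP => // /andP[/eqP-> /eqP->] /=.
by congr (A _ _ _)%:E; lia.
Qed.

(* Main.v *)
Require Import Defs.
From HB Require Import structures.
From mathcomp Require Import all_boot all_order all_algebra.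
From mathcomp Require Import all_classical all_reals all_analysis.

Set Implicit Arguments.
Unset Strict Implicit.
Unset Printing Implicit Defensive.

Import Order.TTheory GRing.Theory Num.Theory.

Local Open Scope classical_set_scope.
Local Open Scope ring_scope.
Local Open Scope ereal_scope.

(** The theorem is a statement about first entrances.  The entry of [Q ^ m D]
    at ((s, p), y) is the probability that the chain started at phase p of
    complement level s first enters the low levels at time m + 1, in state y.
    For distinct m or distinct y these are disjoint events, so the sum over all
    m and y is at most 1.  In matrix terms: with f_n the sum of the row sums of
    [Q ^ m D] for m < n, f_(n+1) = D 1 + Q f_n, and
    D 1 + Q 1 <= 1 because P is stochastic; induction gives f_n <= 1
    ([sum_hit_le1], [hit_series_le1]).

    This bound makes every subtracted quantity finite, so that the extended
    real differences are genuine ones: [Qhat D] splits into the head m <= M,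
    which is the truncated product, and a nonnegative tail, and
    [Delta] = U * tail ([imxB_QhatD], [DeltaE]).  It also bounds the tail: the
    head r_(s,p) already accounts for a part of a total mass at most 1, so any
    entry of the tail in row (s, p) is at most 1 - r_(s,p)
    ([hit_tail_le_gap]).  Multiplying by U gives (b), and since the rows of U
    sum to at most 1, a weighted sum of gaps is at most any common upper bound
    of the gaps, which gives (c).

    The M/G/1 structure enters in two ways.  The chain goes down by at most one
    level per step, so it can enter the low levels only through level N: hence
    the other block columns of [Delta] vanish ([hit_col0]).  For the same reason
    more than m + 1 steps are needed from a complement level s > m
    ([hit_level0]), whence r_(s,p) = 0 as soon as s > M.  The least r_(s,p) is
    therefore 0 and the greatest gap is 1, both attained at complement level
    M + 1. *)

(** * Unordered sums of nonnegative extended reals *)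

Lemma le_esumZl (R : realType) (I : choiceType) (k : \bar R) (a : I -> \bar R) :
  0 <= k -> (forall i, 0 <= a i) ->
  \esum_(i in [set: I]) (k * a i) <= k * \esum_(i in [set: I]) a i.
Proof.
move=> k0 a0; apply: ge_ereal_sup => _ [X [finX XI] <-].
rewrite -ge0_mule_fsumr//; apply: lee_wpmul2l => //.
by apply: esum_ge; exists X.
Qed.

(** For finite [k > 0] the reverse inequality is [le_esumZl] for [k^-1]; for
    [k = +oo] a single nonzero term makes both sides infinite. *)
Lemma esumZl (R : realType) (I : choiceType) (k : \bar R) (a : I -> \bar R) :
  0 <= k -> (forall i, 0 <= a i) ->
  \esum_(i in [set: I]) (k * a i) = k * \esum_(i in [set: I]) a i.
Proof.
move=> k0 a0; have ka0 i : 0 <= k * a i by exact: mule_ge0.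
apply/eqP; rewrite eq_le le_esumZl//=.
have [->|kN0] := eqVneq k 0.
  by rewrite mul0e; apply: esum_ge0 => i _; rewrite mul0e.
have k_gt0 : 0 < k by rewrite lt_neqAle eq_sym kN0.
case: k k0 ka0 kN0 k_gt0 => [c| |] // k0 ka0 kN0 k_gt0.
  rewrite lte_fin in k_gt0.
  rewrite muleC -lee_pdivlMr// muleC.
  apply: le_trans (le_esumZl _ ka0); last by rewrite lee_fin invr_ge0 ltW.
  by apply: le_esum => i _; rewrite muleA -EFinM mulVf ?gt_eqF// mul1e.
have [allz|] := pselect (forall i, a i = 0).
  by rewrite (esum1 (fun i _ => allz i)) mule0 esum_ge0.
move=> /existsNP[i /eqP ai]; apply: (@le_trans _ _ +oo); first exact: leey.
apply: esum_ge; exists [set i]; first by split => //; exact: finite_set1.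
by rewrite fsbig_set1 gt0_mulye// lt_neqAle eq_sym ai a0.
Qed.

Lemma esum_exchange (R : realType) (I J : choiceType) (a : I -> J -> \bar R) :
  (forall i j, 0 <= a i j) ->
  \esum_(i in [set: I]) \esum_(j in [set: J]) a i j =
  \esum_(j in [set: J]) \esum_(i in [set: I]) a i j.
Proof.
move=> a0; rewrite !esum_esum//.
rewrite (@reindex_esum R (J * I)%type (I * J)%type (setT `*`` fun=> setT) _
  (fun x => (x.2, x.1)))//.
by split=> //= [[i j] [i' j'] _ _ [-> ->]//|[i j] _]; exists (j, i).
Qed.

Lemma le_esum_inj (R : realType) (I J : choiceType) (B : set I) (e : J -> I)
    (a : I -> \bar R) :
  injective e -> (forall j, B (e j)) -> (forall i, 0 <= a i) ->
  \esum_(j in [set: J]) a (e j) <= \esum_(i in B) a i.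
Proof.
move=> e_inj eB a0; rewrite -(esum_image setT e a); last by move=> ? ? _ _ /e_inj.
rewrite (esumID (e @` setT) B)// (_ : B `&` _ = e @` setT); last first.
  by apply/setIidPr => _ [j _ <-].
by rewrite leeDl// esum_ge0.
Qed.

Lemma le_esum_term (R : realType) (I : choiceType) (a : I -> \bar R) (i : I) :
  (forall i, 0 <= a i) -> a i <= \esum_(i in [set: I]) a i.
Proof.
move=> a0; apply: esum_ge; exists [set i]; last by rewrite fsbig_set1.
by split => //; exact: finite_set1.
Qed.

Lemma esum_fintype (R : realType) (I : finType) (a : I -> \bar R) :
  (forall i, 0 <= a i) -> \esum_(i in [set: I]) a i = \sum_i a i.
Proof.
move=> a0; rewrite esum_fset//; last exact: finite_finset.
rewrite [RHS]fsbig_seq ?index_enum_uniq//; congr (\sum_(i \in _) _).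
by apply/seteqP; split=> i //= _; rewrite mem_index_enum.
Qed.

Lemma esum_state (R : realType) (r : nat) (a : state r -> \bar R) :
  (forall x, 0 <= a x) ->
  \esum_(x in [set: state r]) a x = \sum_(s <oo) \sum_(p < r) a (s, p).
Proof.
move=> a0; rewrite nneseries_esumT; last by move=> s; exact: sume_ge0.
under [RHS]eq_esum => s _ do rewrite -(esum_fintype (fun p => a0 (s, p))).
rewrite esum_esum//; have -> : [set: nat] `*`` (fun=> [set: 'I_r]) = setT.
  by apply/seteqP; split.
by apply: eq_esum => -[].
Qed.

Lemma fin_num01 (R : realType) (u : \bar R) : 0 <= u -> u <= 1 -> u \is a fin_num.
Proof. by move=> u0 u1; rewrite ge0_fin_numE// (le_lt_trans u1)// ltry. Qed.

(** * Nonnegative infinite matrices *)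

Lemma imxM_ge0 (R : realType) (I K : Type) (J : choiceType)
    (X : imx R I J) (Y : imx R J K) :
  (forall x y, 0 <= X x y) -> (forall y z, 0 <= Y y z) ->
  forall x z, 0 <= imxM X Y x z.
Proof. by move=> X0 Y0 x z; apply: esum_ge0 => y _; exact: mule_ge0. Qed.

Lemma imxM1l (R : realType) (I : choiceType) (J : Type) (X : imx R I J) :
  (forall x y, 0 <= X x y) -> imxM (@imx1 R I) X = X.
Proof.
move=> X0; apply/funext => x; apply/funext => z; rewrite /imxM /imx1.
have t0 y : 0 <= (if x == y then 1 else 0) * X y z.
  by case: eqP => _; rewrite ?mul1e ?mul0e.
rewrite (esumID [set x])// setTI esum_set1// eqxx mul1e esum1 ?adde0//.
by move=> y [_ /eqP xy]; rewrite eq_sym (negbTE xy) mul0e.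
Qed.

Lemma imxMA (R : realType) (I L : Type) (J K : choiceType)
    (X : imx R I J) (Y : imx R J K) (Z : imx R K L) :
  (forall x y, 0 <= X x y) -> (forall x y, 0 <= Y x y) ->
  (forall x y, 0 <= Z x y) ->
  imxM (imxM X Y) Z = imxM X (imxM Y Z).
Proof.
move=> X0 Y0 Z0; apply/funext => x; apply/funext => w; rewrite /imxM.
under eq_esum => z _.
  rewrite muleC -esumZl//; last by move=> y; exact: mule_ge0.
  over.
rewrite esum_exchange; last by move=> z y; rewrite !mule_ge0.
apply: eq_esum => y _; rewrite -esumZl//; last by move=> z; exact: mule_ge0.
by apply: eq_esum => z _; rewrite muleC muleA.
Qed.

Lemma imxMDr (R : realType) (I K : Type) (J : choiceType)
    (X : imx R I J) (Y Z : imx R J K) :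
  (forall x y, 0 <= X x y) -> (forall x y, 0 <= Y x y) ->
  (forall x y, 0 <= Z x y) ->
  imxM X (imxD Y Z) = imxD (imxM X Y) (imxM X Z).
Proof.
move=> X0 Y0 Z0; apply/funext => x; apply/funext => z; rewrite /imxM /imxD.
rewrite -esumD; last 2 first.
- by move=> y _; exact: mule_ge0.
- by move=> y _; exact: mule_ge0.
by apply: eq_esum => y _; rewrite ge0_muleDr.
Qed.

Lemma imxDKl (R : realType) (I J : Type) (X Y : imx R I J) :
  (forall x y, X x y \is a fin_num) -> imxB (imxD X Y) X = Y.
Proof.
move=> fX; apply/funext => x; apply/funext => y.
by rewrite /imxB /imxD addeAC subee// add0e.
Qed.

Lemma imxX_ge0 (R : realType) (I : choiceType) (X : imx R I I) m :
  (forall x y, 0 <= X x y) -> forall x y, 0 <= imxX X m x y.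
Proof.
move=> X0; elim: m => [|m IH] x y; first by rewrite /= /imx1; case: ifP.
exact: imxM_ge0.
Qed.

(** * First entrance into the low levels *)

(** Probability that the chain started at the high state [x] stays in the high
    levels up to time [m] and enters the low levels at time [m.+1], in state
    [y]. *)
Definition hit (R : realType) (r : nat) (P : state r -> state r -> R)
    (N m : nat) : imx R (state r) (low N r) :=
  imxM (imxX (blockQ P N) m) (blockD P N).
Arguments hit {R r} P N m x y.

Definition hit_head (R : realType) (r : nat) (P : state r -> state r -> R)
    (N M : nat) : imx R (state r) (low N r) :=
  fun x y => \sum_(m < M.+1) hit P N m x y.
Arguments hit_head {R r} P N M x y.

Definition hit_tail (R : realType) (r : nat) (P : state r -> state r -> R)
    (N M : nat) : imx R (state r) (low N r) :=
  fun x y => \sum_(M.+1 <= m <oo) hit P N m x y.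
Arguments hit_tail {R r} P N M x y.

Section stochastic.

Variables (R : realType) (r : nat) (P : state r -> state r -> R) (N : nat).
Hypothesis P_st : stochastic P.

Let Q0 x y : 0 <= blockQ P N x y. Proof. by rewrite lee_fin; case: P_st. Qed.
Let D0 x y : 0 <= blockD P N x y. Proof. by rewrite lee_fin; case: P_st. Qed.

Lemma blockU_ge0 x y : 0 <= blockU P N x y.
Proof. by rewrite lee_fin; case: P_st. Qed.

Let QX0 m x y : 0 <= imxX (blockQ P N) m x y. Proof. exact: imxX_ge0. Qed.

Lemma hit_ge0 m x y : 0 <= hit P N m x y. Proof. exact: imxM_ge0. Qed.

Lemma hit0 : hit P N 0 = blockD P N. Proof. exact: imxM1l. Qed.

Lemma hitS m : hit P N m.+1 = imxM (blockQ P N) (hit P N m).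
Proof. exact: imxMA. Qed.

Lemma hit_head_ge0 M x y : 0 <= hit_head P N M x y.
Proof. by apply: sume_ge0 => m _; exact: hit_ge0. Qed.

Lemma hit_tail_ge0 M x y : 0 <= hit_tail P N M x y.
Proof. by apply: nneseries_ge0 => m _ _; exact: hit_ge0. Qed.

Lemma Qhat_truncD M : imxM (Qhat_trunc P N M) (blockD P N) = hit_head P N M.
Proof.
apply/funext => x; apply/funext => y; rewrite /imxM /Qhat_trunc /hit_head /hit.
under eq_esum => z _ do rewrite ge0_sume_distrl//.
by rewrite esum_sum// => z m _ _; exact: mule_ge0.
Qed.

Lemma QhatD M :
  imxM (Qhat P N) (blockD P N) = imxD (hit_head P N M) (hit_tail P N M).
Proof.
apply/funext => x; apply/funext => y; transitivity (\sum_(m <oo) hit P N m x y).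
  rewrite nneseries_esumT; last by move=> m; exact: hit_ge0.
  rewrite /hit /imxM esum_exchange; last by move=> m z; exact: mule_ge0.
  apply: eq_esum => z _; rewrite muleC /Qhat nneseries_esumT// -esumZl//.
  by apply: eq_esum => m _; rewrite muleC.
rewrite (nneseries_split _ M.+1); last by move=> m _; exact: hit_ge0.
by rewrite add0n big_mkord.
Qed.

Lemma of_low_inj : injective (@of_low N r).
Proof. by move=> [i a] [j b] [/val_inj -> ->]. Qed.

Lemma of_high_inj : injective (@of_high N r).
Proof. by move=> [i a] [j b] [/addnI -> ->]. Qed.

(** The low and the high states are disjoint, so a row of D and the matching row
    of Q consist of different entries of one row of [P]. *)
Lemma blockDQ_le1 x :
  \esum_(y in [set: low N r]) blockD P N x y +
  \esum_(y in [set: state r]) blockQ P N x y <= 1.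
Proof.
case: P_st => P0 /(_ (of_high N x)) <-.
pose B := [set y : state r | (y.1 <= N)%N].
rewrite [leRHS](esumID B); last by move=> y _; rewrite lee_fin.
rewrite !setTI; apply: leeD.
- apply: (le_esum_inj (a := fun z => (P (of_high N x) z)%:E)) => [|y|z].
  + exact: of_low_inj.
  + by rewrite /B /= -ltnS.
  + by rewrite lee_fin.
- apply: (le_esum_inj (a := fun z => (P (of_high N x) z)%:E)) => [|y|z].
  + exact: of_high_inj.
  + by apply/negP; rewrite -ltnNge ltnS leq_addr.
  + by rewrite lee_fin.
Qed.

Lemma blockU_le1 x : \esum_(y in [set: state r]) blockU P N x y <= 1.
Proof.
case: P_st => P0 /(_ (of_low x)) <-.
apply: (le_esum_inj (a := fun z => (P (of_low x) z)%:E)) => [|y|z] //.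
- exact: of_high_inj.
- by rewrite lee_fin.
Qed.

(** Conditioning on the first step: an entrance takes place at once, or the chain
    makes a step of [Q] and enters later. *)
Lemma sum_hit_le1 n x :
  \sum_(m < n) \esum_(y in [set: low N r]) hit P N m x y <= 1.
Proof.
elim: n x => [|n IH] x; first by rewrite big_ord0.
rewrite big_ord_recl hit0; apply: le_trans (blockDQ_le1 x); apply: leeD2l.
have hit_sum0 m z : 0 <= \esum_(y in [set: low N r]) hit P N m z y.
  by apply: esum_ge0 => y _; exact: hit_ge0.
under eq_bigr => m _.
  rewrite /= /bump /= add1n hitS /imxM esum_exchange; last first.
    by move=> y z; rewrite mule_ge0// hit_ge0.
  under eq_esum => z _ do rewrite (esumZl (Q0 x z) (fun y => hit_ge0 m z y)).
  over.
rewrite -esum_sum; last by move=> z m _ _; exact: mule_ge0.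
apply: le_esum => z _; rewrite -ge0_sume_distrr// -[leRHS]mule1.
exact: lee_wpmul2l.
Qed.

Lemma hit_series_le1 x :
  \sum_(m <oo) \esum_(y in [set: low N r]) hit P N m x y <= 1.
Proof.
apply: lime_le; last by apply: nearW => n; rewrite big_mkord; exact: sum_hit_le1.
by apply: is_cvg_nneseries => m _ _; apply: esum_ge0 => y _; exact: hit_ge0.
Qed.

Lemma hit_head_le1 M x y : hit_head P N M x y <= 1.
Proof.
apply: le_trans (sum_hit_le1 M.+1 x); apply: lee_sum => m _.
by apply: le_esum_term => z; exact: hit_ge0.
Qed.

(** * The error matrix and its bound *)

Lemma imxB_QhatD M :
  imxB (imxM (Qhat P N) (blockD P N)) (imxM (Qhat_trunc P N M) (blockD P N)) =
  hit_tail P N M.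
Proof.
rewrite (QhatD M) Qhat_truncD imxDKl// => x y.
by apply: fin_num01; [exact: hit_head_ge0|exact: hit_head_le1].
Qed.

(** The blocks [blockT] and the head contribution cancel because they are
    finite: each row of U sums to at most 1 and the head is at most 1. *)
Lemma DeltaE M : Delta P N M = imxM (blockU P N) (hit_tail P N M).
Proof.
rewrite /Delta /censored /censored_trunc (QhatD M) Qhat_truncD imxMDr; last 3 first.
- exact: blockU_ge0.
- exact: hit_head_ge0.
- exact: hit_tail_ge0.
apply/funext => x; apply/funext => y; rewrite /imxB /imxD addeA.
have UH0 : 0 <= imxM (blockU P N) (hit_head P N M) x y.
  by apply: imxM_ge0; [exact: blockU_ge0|exact: hit_head_ge0].
rewrite [LHS]addeAC subee ?add0e// fin_numD /=; apply: fin_num01 => //.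
apply: le_trans (blockU_le1 x); apply: le_esum => z _.
by rewrite -[leRHS]mule1; apply: lee_wpmul2l; [exact: blockU_ge0|exact: hit_head_le1].
Qed.

Lemma Gcol_ge0 m x d : 0 <= Gcol P N m x d.
Proof. exact: hit_ge0. Qed.

Lemma rsum_ge0 M s p : 0 <= rsum P N M s p.
Proof. by apply: sume_ge0 => m _; apply: sume_ge0 => d _; exact: Gcol_ge0. Qed.

(** Both summands belong to the series of all entrance probabilities from (s, p):
    [rsum] to its terms of index at most [M], the tail to the later ones. *)
Lemma rsum_tail_le1 M s p b :
  rsum P N M s p + hit_tail P N M (s, p) (ord_max, b) <= 1.
Proof.
have G0 m : 0 <= \sum_(d < r) Gcol P N m (s, p) d.
  by apply: sume_ge0 => d _; exact: Gcol_ge0.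
apply: (@le_trans _ _ (\sum_(m <oo) \sum_(d < r) Gcol P N m (s, p) d)).
  rewrite [leRHS](nneseries_split _ M.+1)// add0n big_mkord leeD2l//.
  apply: lee_nneseries => m *; first exact: hit_ge0.
  rewrite -esum_fintype; last by move=> d; exact: Gcol_ge0.
  by apply: (le_esum_term (a := Gcol P N m (s, p))) => d; exact: Gcol_ge0.
apply: le_trans (hit_series_le1 (s, p)); apply: lee_nneseries => // m _.
rewrite -esum_fintype; last by move=> d; exact: Gcol_ge0.
apply: (le_esum_inj (a := hit P N m (s, p))) => // [d d' [] //|y].
exact: hit_ge0.
Qed.

Lemma rsum_le1 M s p : rsum P N M s p <= 1.
Proof. by apply: le_trans (rsum_tail_le1 M s p p); rewrite leeDl// hit_tail_ge0. Qed.

Lemma hit_tail_le_gap M s p b :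
  hit_tail P N M (s, p) (ord_max, b) <= 1 - rsum P N M s p.
Proof.
rewrite leeBrDl ?rsum_tail_le1// fin_num01//; [exact: rsum_ge0|exact: rsum_le1].
Qed.

Lemma gap_ge0 M s p : 0 <= 1 - rsum P N M s p.
Proof. by rewrite sube_ge0 ?rsum_le1// fin_num01//; [exact: rsum_ge0|exact: rsum_le1]. Qed.

Lemma Delta_le_gap M (i : 'I_N.+1) (a b : 'I_r) :
  Delta P N M (i, a) (ord_max, b) <=
  \sum_(s <oo) \sum_(p < r)
     (blockU P N (i, a) (s, p) * (1 - rsum P N M s p)).
Proof.
rewrite DeltaE -(esum_state (a := fun x => _ x * (1 - rsum P N M x.1 x.2))); last first.
  by move=> x; rewrite mule_ge0 ?blockU_ge0 ?gap_ge0.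
apply: le_esum => -[s p] _; apply: lee_wpmul2l; first exact: blockU_ge0.
exact: hit_tail_le_gap.
Qed.

(** * Consequences of the M/G/1 structure *)

Hypothesis P_MG1 : MG1_type P.

Lemma hit_col0 m x (j : 'I_N.+1) b : j != ord_max -> hit P N m x (j, b) = 0.
Proof.
move=> jN; have [B [A [_ _ PE]]] := P_MG1.
apply: esum1 => -[t q] _; rewrite (@blockD_MG1 _ _ _ _ _ _ _ _ _ _ PE) (negbTE jN) andbF.
by rewrite mule0.
Qed.

(** One step lowers the level by at most 1, and D can be used only from
    complement level 0. *)
Lemma hit_level0 m s p y : (m < s)%N -> hit P N m (s, p) y = 0.
Proof.
have [B [A [_ _ PE]]] := P_MG1; elim: m s p => [|m IH] s p ms.
  by rewrite hit0; case: y => j b; rewrite (@blockD_MG1 _ _ _ _ _ _ _ _ _ _ PE) gtn_eqF.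
rewrite hitS; apply: esum1 => -[t q] _.
have [mt|tm] := ltnP m t; first by rewrite IH// mule0.
by rewrite (@blockQ_MG1 _ _ _ _ _ _ _ _ _ _ PE) leqNgt (leq_ltn_trans _ ms)// mul0e.
Qed.

Lemma rsum_level0 M s p : (M < s)%N -> rsum P N M s p = 0.
Proof.
move=> Ms; apply: big1 => m _; apply: big1 => d _; apply: hit_level0.
exact: leq_trans (ltn_ord m) Ms.
Qed.

End stochastic.

Theorem theorem5p2 (R : realType) (r N M : nat) (r_gt0 : (0 < r)%N)
    (P : state r -> state r -> R)
    (P_stochastic : stochastic P) (P_MG1 : MG1_type P)
    (P_posrec : positive_recurrent P) :
  (* form of the error matrix *)
  [/\ Delta P N M =
        imxM (blockU P N)
             (imxB (imxM (Qhat P N) (blockD P N))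
                   (imxM (Qhat_trunc P N M) (blockD P N))),
      last_col (Delta P N M) = imxM (blockU P N) (Ecol P N M)
    & forall x (j : 'I_N.+1) b, j != ord_max -> Delta P N M x (j, b) = 0]
  /\
  (* (a) *)
  [/\ forall s p d,
        Ecol P N M (s, p) d = \sum_(M.+1 <= m <oo) Gcol P N m (s, p) d,
      forall x d, 0 <= Ecol P N M x d
    & forall x y, 0 <= Delta P N M x y]
  /\
  (* (b) *)
  (forall (i : 'I_N.+1) (a b : 'I_r),
     Delta P N M (i, a) (ord_max, b) <=
       \sum_(s <oo) \sum_(p < r)
          (blockU P N (i, a) (s, p) * (1 - rsum P N M s p)))
  /\
  (* (c): the supremum and the infimum are attained, i.e. are a max and a min *)
  (let rs := [set rsum P N M sp.1 sp.2 | sp in [set: state r]] in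
   let gaps := [set 1 - rsum P N M sp.1 sp.2 | sp in [set: state r]] in
   [/\ gaps (ereal_sup gaps) /\ rs (ereal_inf rs),
       \big[maxe/-oo]_(i < N.+1) \big[maxe/-oo]_(a < r) \big[maxe/-oo]_(b < r)
          Delta P N M (i, a) (ord_max, b) <= ereal_sup gaps,
       forall eps : R, (0 < eps)%R ->
         ((1 - eps)%R%:E <= ereal_inf rs <-> ereal_sup gaps <= eps%:E)
     & forall eps : R, (0 < eps)%R -> (1 - eps)%R%:E <= ereal_inf rs ->
         forall x y, Delta P N M x y <= eps%:E]).
Proof.
(* Any common upper bound [c] of the gaps bounds the average in (b). *)
have Delta_le_sup (i : 'I_N.+1) (a b : 'I_r) c :
    (forall s p, 1 - rsum P N M s p <= c) ->
    Delta P N M (i, a) (ord_max, b) <= c.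
  move=> gap_c.
  have c0 : 0 <= c := le_trans (gap_ge0 N P_stochastic M 0 a) (gap_c _ _).
  apply: le_trans (Delta_le_gap P_stochastic M i a b) _.
  rewrite -(esum_state (a := fun x =>
      blockU P N (i, a) x * (1 - rsum P N M x.1 x.2))); last first.
    move=> [s p]; apply: mule_ge0; [exact: blockU_ge0|exact: gap_ge0].
  apply: (@le_trans _ _ (\esum_(x in [set: state r]) (c * blockU P N (i, a) x))).
    apply: le_esum => -[s p] _; rewrite muleC; apply: lee_wpmul2r => //.
    exact: blockU_ge0.
  rewrite esumZl//; last by move=> x; exact: blockU_ge0.
  by rewrite -[leRHS]mule1; apply: lee_wpmul2l => //; exact: blockU_le1.
have Delta_col0 x (j : 'I_N.+1) b : j != ord_max -> Delta P N M x (j, b) = 0.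
  move=> jN; rewrite DeltaE//; apply: esum1 => z _.
  by rewrite /hit_tail eseries0 ?mule0// => m _ _; exact: hit_col0.
have tail0 := hit_tail_ge0 (N := N) P_stochastic M.
have EcolE : Ecol P N M = last_col (hit_tail P N M).
  by rewrite -imxB_QhatD.
pose p0 := Ordinal r_gt0.
split; [|split; [|split]].
- split=> //; first by rewrite imxB_QhatD// DeltaE.
  by rewrite EcolE DeltaE.
- split=> [s p d|x d|x y]; rewrite ?EcolE//; first exact: tail0.
  rewrite DeltaE//; apply: imxM_ge0 => // ? ?; exact: blockU_ge0.
- exact: Delta_le_gap.
- move=> rs gaps.
  (* From complement level M + 1 the low levels are more than M + 1 steps away,
     so that it realizes both extrema. *)
  have rM : rsum P N M M.+1 p0 = 0 by exact: rsum_level0.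
  have gaps1 : gaps 1 by exists (M.+1, p0) => //=; rewrite rM sube0.
  have rs0 : rs 0 by exists (M.+1, p0).
  have sup1 : ereal_sup gaps = 1.
    apply/eqP; rewrite eq_le ereal_sup_ubound// andbT.
    apply: ge_ereal_sup => _ [[s p] _ <-] /=.
    by rewrite leeBlDr ?leeDl ?rsum_ge0// fin_num01 ?rsum_ge0 ?rsum_le1.
  have inf0 : ereal_inf rs = 0.
    apply/eqP; rewrite eq_le ereal_inf_lbound//=.
    by apply: le_ereal_inf_tmp => _ [[s p] _ <-] /=; exact: rsum_ge0.
  have gap_sup s p : 1 - rsum P N M s p <= ereal_sup gaps.
    by apply: ereal_sup_ubound; exists (s, p).
  have sup_inf eps : (1 - eps)%R%:E <= ereal_inf rs <-> ereal_sup gaps <= eps%:E.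
    by rewrite sup1 inf0 !lee_fin subr_le0.
  split=> // [||eps eps0 /sup_inf sup_eps [i a] [j b]].
  + by rewrite sup1 inf0.
  + do 3!(apply: bigmax_le; [exact: leNye|move=> ? _]).
    exact: Delta_le_sup.
  + have [->|jN] := eqVneq j ord_max.
      by apply: le_trans sup_eps; exact: Delta_le_sup.
    by rewrite Delta_col0// lee_fin ltW.
Qed.
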